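(* Let $r\geq 3$ and let $D$ be an $m$-colored semicomplete $r$-partite digraph such that every $\overrightarrow{C}_4$ contained in $D$ is at most $2$-colored, and such that either every $\overrightarrow{C}_5$ contained in $D$ is at most $3$-colored, or every $\overrightarrow{C}_3\uparrow\overrightarrow{C}_3$ contained in $D$ is at most $2$-colored. Then $D$ has a $3$-colored kernel.
   Context: A semicomplete $r$-partite digraph ($r\ge 2$) is a digraph whose vertex set is partitioned into $r$ nonempty independent sets (partite sets) such that for any two vertices $u,v$ in different partite sets at least one of the arcs $(u,v)$, $(v,u)$ is present (both may be present); there are no arcs inside a partite set. An $m$-colored digraph is a digraph whose arcs are each assigned one of $m$ colors. A directed path (no repeated vertices) is $j$-colored if its arcs use exactly $j$ distinct colors. ''Contained in $D$'' means being a subdigraph of $D$; a subdigraph is at most $k$-colored if its arcs use at most $k$ colors. $\overrightarrow{C}_n$ is the directed cycle of length $n$. $\overrightarrow{C}_3\uparrow\overrightarrow{C}_3$ denotes the digraph on four distinct vertices $a,b,c,d$ with arcs $a\to b$, $b\to c$, $c\to a$, $a\to d$, $d\to c$, i.e. two directed $3$-cycles $(a,b,c,a)$ and $(a,d,c,a)$ sharing exactly the arc $c\to a$. A $k$-colored kernel of $D$ is a nonempty set $K\subseteq V(D)$ such that (a) for every $u\in V(D)\setminus K$ there exist $v\in K$ and a $j$-colored directed path from $u$ to $v$ with $1\le j\le k$, and (b) for all distinct $u,v\in K$ there is no $j$-colored directed path from $u$ to $v$ with $1\le j\le k$. *)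

(* Defs.v *)
From mathcomp Require Import all_boot.
Set Implicit Arguments. Unset Strict Implicit. Unset Printing Implicit Defensive.

(* A digraph on a finite vertex type V is an arc relation [arc : rel V];
   an arc-colouring assigns a colour (a natural number) [col u v] to each
   pair; only its values on arcs matter. The number m of colours plays no
   role and is left implicit. *)

Definition ncolors (s : seq nat) : nat := size (undup s).

Definition semicomplete_multipartite (V : finType) (r : nat)
  (arc : rel V) (part : V -> 'I_r) : Prop :=
  [/\ 2 <= r,
      (forall i : 'I_r, exists v : V, part v = i),
      (forall u v : V, part u = part v -> ~~ arc u v) &
      (forall u v : V, part u <> part v -> arc u v || arc v u)].

Definition path_colors (V : finType) (col : V -> V -> nat) (u : V) (p : seq V)
  : seq nat := pairmap col u p.

Definition colored_path_le (V : finType) (arc : rel V) (col : V -> V -> nat)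
  (k : nat) (u v : V) : Prop :=
  exists p : seq V,
    [/\ p != [::], uniq (u :: p), path arc u p, last u p = v &
        1 <= ncolors (path_colors col u p) <= k].

Definition C4_at_most_2 (V : finType) (arc : rel V) (col : V -> V -> nat) : Prop :=
  forall a b c d : V, uniq [:: a; b; c; d] ->
    arc a b -> arc b c -> arc c d -> arc d a ->
    ncolors [:: col a b; col b c; col c d; col d a] <= 2.

Definition C5_at_most_3 (V : finType) (arc : rel V) (col : V -> V -> nat) : Prop :=
  forall a b c d e : V, uniq [:: a; b; c; d; e] ->
    arc a b -> arc b c -> arc c d -> arc d e -> arc e a ->
    ncolors [:: col a b; col b c; col c d; col d e; col e a] <= 3.

Definition C3upC3_at_most_2 (V : finType) (arc : rel V) (col : V -> V -> nat) : Prop :=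
  forall a b c d : V, uniq [:: a; b; c; d] ->
    arc a b -> arc b c -> arc c a -> arc a d -> arc d c ->
    ncolors [:: col a b; col b c; col c a; col a d; col d c] <= 2.

Definition k_colored_kernel (V : finType) (arc : rel V) (col : V -> V -> nat)
  (k : nat) (K : {set V}) : Prop :=
  [/\ K != set0,
      (forall u, u \notin K -> exists2 v, v \in K & colored_path_le arc col k u v) &
      (forall u v, u \in K -> v \in K -> u != v -> ~ colored_path_le arc col k u v)].

(* Main.v *)
Require Import Defs.
From mathcomp Require Import all_boot.

(** Write u => v when some directed path from u to v has at most 3 colors.
    A shortest path of length 4 has at most 3 colors, by the hypotheses on
    the 4-cycles and on the 5-cycles (or the C3^C3), so u => v holds as soon
    as u and v are distinct and at distance at most 4.  On the other hand, in
    a semicomplete multipartite digraph, the relation "u reaches v, and v is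
    at distance more than 4 from u" is transitive, and it contains the
    asymmetric part of =>.  So the asymmetric part of => is acyclic, and any
    finite relation with that property has a kernel. *)

Set Implicit Arguments.
Unset Strict Implicit.
Unset Printing Implicit Defensive.

(** * Kernels of finite relations *)

Lemma strict_order_sink (V : finType) (T : rel V) (S : {set V}) :
  irreflexive T -> transitive T -> S != set0 ->
  exists2 v, v \in S & {in S, forall w, ~~ T v w}.
Proof.
move=> Tirr Ttr /set0Pn[v0 v0S].
(* A vertex with fewest [T]-successors in [S] is a sink: by transitivity and irreflexivity, any
   successor of it would have strictly fewer. *)
pose below v := #|[set w in S | T v w]|.
case: (arg_minnP below v0S) => v vS v_min; exists v => // w wS.
apply/negP => Tvw; have := v_min w wS; rewrite leqNgt => /negP; apply.
apply: proper_card; apply/properP; split.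
  by apply/subsetP => x; rewrite !inE => /andP[-> /(Ttr _ _ _ Tvw)].
by exists w; rewrite !inE ?wS ?Tirr.
Qed.

(** Induction on the size of [S]: a [T]-sink [v] of [S] joins a kernel of the set [S'] of vertices
    not related to [v]. If [R v w] held for such a [w], it would be asymmetric, hence [T v w], which
    a sink excludes. *)
Lemma kernel_of_acyclic_asymmetric_part (V : finType) (R T : rel V)
    (S : {set V}) :
  irreflexive T -> transitive T ->
  (forall u v, R u v -> ~~ R v u -> T u v) ->
  exists K : {set V},
    [/\ K \subset S,
        (forall u, u \in S -> u \notin K -> exists2 v, v \in K & R u v) &
        {in K &, forall u v, u != v -> ~~ R u v}].
Proof.
move=> Tirr Ttr RT; have [n] := ubnP #|S|.
elim: n S => // n IHn S; rewrite ltnS => leSn.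
have [->|Sn0] := eqVneq S set0.
  by exists set0; split => // [u|u v]; rewrite inE.
have [v vS v_sink] := strict_order_sink Tirr Ttr Sn0.
pose S' := [set u in S | (u != v) && ~~ R u v].
have S'S : S' \subset S by apply/subsetP => u; rewrite inE => /andP[].
have ltS'n : #|S'| < n.
  apply: leq_trans leSn; apply: proper_card; apply/properP; split => //.
  by exists v; rewrite // inE eqxx andbF.
have [K [KS' Kabs Kind]] := IHn S' ltS'n.
exists (v |: K); split.
- by rewrite subUset sub1set vS (subset_trans KS').
- move=> u uS; rewrite in_setU1 negb_or => /andP[uv uK].
  have [Ruv|nRuv] := boolP (R u v); first by exists v; rewrite ?setU11.
  have [|w wK Ruw] := Kabs u _ uK; first by rewrite inE uS uv.
  by exists w; rewrite // setU1r.
have vK w : w \in K -> ~~ R w v && ~~ R v w.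
  move/(subsetP KS'); rewrite inE => /and3P[wS _ nRwv].
  rewrite nRwv; apply: contra (v_sink w wS) => Rvw; exact: RT.
move=> u w /setU1P[-> | uK] /setU1P[-> | wK] uw; first by rewrite eqxx in uw.
- by case/andP: (vK w wK).
- by case/andP: (vK u uK).
exact: Kind.
Qed.

(** * Colors of paths, and short walks *)

Lemma ncolors_sub (s t : seq nat) : {subset s <= t} -> ncolors s <= ncolors t.
Proof.
move=> st; apply: uniq_leq_size; first exact: undup_uniq.
by move=> x; rewrite !mem_undup => /st.
Qed.

Lemma ncolors_cons c s : ncolors (c :: s) <= (ncolors s).+1.
Proof. by rewrite /ncolors /=; case: ifP. Qed.

Section ColoredPaths.

Variables (V : finType) (arc : rel V) (col : V -> V -> nat).

(** A path without repetition has at most [#|V|] arcs, so bounded sequences suffice and the relation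
    becomes Boolean. *)
Definition colored_path_leb k u v :=
  [exists p : #|V|.-bseq V,
    [&& val p != [::], uniq (u :: p), path arc u p, last u p == v &
        0 < ncolors (path_colors col u p) <= k]].

Lemma colored_path_leP k u v :
  reflect (colored_path_le arc col k u v) (colored_path_leb k u v).
Proof.
apply: (iffP existsP) => [[p /and5P[pn up Pp /eqP lp cp]]|[p [pn up Pp lp cp]]].
  by exists p.
have szp : size p <= #|V|.
  by apply: leq_trans (max_card (mem p)); case/andP: up => _ /card_uniqP->.
by exists (Bseq szp); rewrite pn up Pp lp eqxx.
Qed.

Lemma colored_path_le_connect k u v :
  colored_path_le arc col k u v -> connect arc u v.
Proof. by case=> p [_ _ Pp <- _]; apply/connectP; exists p. Qed.

Lemma uniq_colored_path_le k u p :
  uniq (u :: p) -> path arc u p -> u != last u p ->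
  ncolors (path_colors col u p) <= k ->
  colored_path_le arc col k u (last u p).
Proof.
move=> up Pp; case: p => [|x p] in up Pp *; first by rewrite eqxx.
move=> _ cp; exists (x :: p); split=> //; rewrite cp andbT /ncolors.
by rewrite lt0n size_eq0; apply/eqP => /undup_nil.
Qed.

Lemma short_colored_path_le k u p :
  path arc u p -> size p <= k -> u != last u p ->
  colored_path_le arc col k u (last u p).
Proof.
move=> Pp szp; case: (shortenP Pp) => q Pq uq qp nuv.
apply: uniq_colored_path_le => //; apply: leq_trans (size_undup _) _.
rewrite /path_colors size_pairmap; apply: leq_trans szp.
by apply: uniq_leq_size => //; case/andP: uq.
Qed.

(** Repeated vertices are allowed, so the walks built below need no check of distinctness; the empty
    walk counts, so [near u u] holds. *)
Definition near u v :=
  [exists p : 4.-bseq V, path arc u p && (last u p == v)].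

Lemma nearP u v :
  reflect (exists p, [/\ path arc u p, last u p = v & size p <= 4]) (near u v).
Proof.
apply: (iffP existsP) => [[p /andP[Pp /eqP lp]]|[p [Pp lp szp]]].
  by exists p; split=> //; apply: size_bseq.
by exists (Bseq szp); rewrite Pp lp eqxx.
Qed.

Lemma path_near u p : path arc u p -> size p <= 4 -> near u (last u p).
Proof. by move=> Pp szp; apply/nearP; exists p. Qed.

(** * Distances in semicomplete multipartite digraphs *)

Section SemicompleteMultipartite.

Variables (r : nat) (part : V -> 'I_r).
Hypothesis indep : forall u v, part u = part v -> ~~ arc u v.
Hypothesis semicomplete : forall u v, part u <> part v -> arc u v || arc v u.

Lemma arc_part u v : arc u v -> part u != part v.
Proof. by move=> uv; apply/eqP => /indep; rewrite uv. Qed.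

Lemma arc_rev u v : part u != part v -> ~~ arc u v -> arc v u.
Proof. by move/eqP/semicomplete/orP => [->|]. Qed.

(* If near u v fails, every out-neighbor of u is one of v.  Follow the
   path from u to v up to the first z with an arc z -> u: one of the two
   vertices before z is u or an out-neighbor of u, hence of v. *)
Lemma connect_same_part_near u v :
  part u = part v -> connect arc u v -> near u v || near v u.
Proof.
move=> puv /connectP[p Pp lp]; case: (boolP (near u v)) => //= nuv.
have first_out z : arc u z -> arc v z.
  move=> uz; apply: arc_rev; first by rewrite -puv eq_sym arc_part.
  apply: contra nuv => zv.
  by apply: (@path_near u [:: z; v]); rewrite //= uz zv.
have nearv z : arc z u -> arc u z -> near v u.
  move=> zu uz.
  by apply: (@path_near v [:: z; u]); rewrite //= zu first_out.
have last_in z : arc z v -> arc z u.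
  move=> zv; apply: arc_rev; first by rewrite puv eq_sym arc_part.
  apply: contra nuv => uz.
  by apply: (@path_near u [:: z; v]); rewrite //= uz zv.
(* Two consecutive vertices never share a part. So, as long as no arc back to [u] appears, each
   vertex met is [u], an out-neighbor of [u], or a vertex in the part of [u] just after an
   out-neighbor. *)
have step x q : arc u x || (part x == part u) &&
      ((x == u) || [exists y, arc u y && arc y x]) ->
    path arc x q -> v = last x q -> size q > 0 -> near v u.
  elim: q x => // z q IHq x x_inv /= /andP[xz Pq] lq _.
  have out_or_near : part z != part u -> arc u z \/ near v u.
    move=> pz; have [zu|nzu] := boolP (arc z u); last first.
      by left; apply: arc_rev nzu.
    right; case/orP: x_inv => [ux|/andP[_ /orP[/eqP xu|/existsP[y]]]].
    - apply: (@path_near v [:: x; z; u]); rewrite //= zu xz andbT.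
      by rewrite first_out.
    - by rewrite xu in xz; apply: nearv zu xz.
    - case/andP=> uy yx.
      (* This walk is the one that needs all four arcs allowed by [near]. *)
      apply: (@path_near v [:: y; x; z; u]); rewrite //= zu xz yx !andbT.
      exact: first_out.
  have [pz|pz] := eqVneq (part z) (part u); last first.
    have [uz|//] := out_or_near pz.
    have [q0|q_gt0] := posnP (size q); last by apply: (IHq z); rewrite ?uz.
    by move/size0nil: q0 pz lq => -> /= pz vz; rewrite -vz -puv eqxx in pz.
  have ux : arc u x.
    by case/orP: x_inv => // /andP[/eqP px _]; move: (arc_part xz); rewrite px pz eqxx.
  have [q0|q_gt0] := posnP (size q).
    move/size0nil: q0 => q0; rewrite q0 /= in lq; rewrite -lq in xz.
    by apply: nearv (last_in _ xz) ux.
  apply: (IHq z) => //; apply/orP; right; rewrite pz eqxx /=.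
  by apply/orP; right; apply/existsP; exists x; rewrite ux.
case: p Pp lp => [_ /= -> |x p Pp lp].
  by apply: (@path_near u [::]).
by apply: (step u (x :: p)); rewrite // !eqxx /= orbT.
Qed.

Definition far_above u v := connect arc u v && ~~ near v u.

Lemma far_above_irr : irreflexive far_above.
Proof. by move=> u; rewrite /far_above (@path_near u [::]) ?andbF. Qed.

(** Suppose a walk of length at most 4 leads from [w] to [u]. Its vertices within 3 steps of [w]
    have no arc to [v], as [near w v] fails, so those outside the part of [v] are out-neighbors of
    [v]. One of the last vertices of the walk is such, and [v] reaches [u] in at most 3 steps. *)
Lemma far_above_trans : transitive far_above.
Proof.
move=> v u w /andP[cuv nvu] /andP[cvw nwv].
rewrite /far_above (connect_trans cuv cvw) /=.
apply/negP => /nearP[p [Pp lp szp]].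
have dom s : path arc w s -> size s <= 3 ->
    part v != part (last w s) -> arc v (last w s).
  move=> Ps szs pvs; apply: arc_rev; first by rewrite eq_sym.
  apply: contra nwv => sv.
  rewrite -(last_rcons w s v); apply: path_near.
    by rewrite rcons_path Ps.
  by rewrite size_rcons.
case/lastP: p => [|p z] in Pp lp szp *.
  (* The empty walk: here [w] is [u], and neither of [u] and [v] is near the other. *)
  move: lp cvw nwv => /= -> cvu nuv.
  have [puv|] := eqVneq (part u) (part v).
    by have := connect_same_part_near puv cuv; rewrite (negPf nuv) (negPf nvu).
  move=> pd; case/eqP/semicomplete/orP: pd => a.
    by case/negP: nuv; apply: (@path_near u [:: v]); rewrite //= a.
  by case/negP: nvu; apply: (@path_near v [:: u]); rewrite //= a.
move: Pp lp szp; rewrite last_rcons size_rcons rcons_path => /andP[Pp pz] zu.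
rewrite {z}zu in pz *; rewrite ltnS => szp.
have [pvp|pvp] := eqVneq (part v) (part (last w p)); last first.
  case/negP: nvu; apply: (@path_near v [:: last w p; u]) => //=.
  by rewrite pz dom.
case/lastP: p => [|p y] in Pp pz szp pvp *.
  have wu : arc w u by [].
  case/negP: nvu; apply: (@path_near v [:: u]) => //=; rewrite andbT.
  apply: (dom [:: u]); rewrite /= ?wu //.
  by rewrite pvp /= arc_part.
move: Pp pz szp pvp; rewrite last_rcons size_rcons rcons_path.
move=> /andP[Pp py] yu szp pvy.
case/negP: nvu; apply: (@path_near v [:: last w p; y; u]) => //=.
rewrite py yu dom //; first exact: ltnW.
by rewrite pvy eq_sym arc_part.
Qed.

(** * Colors along shortest paths *)

Hypothesis C4 : C4_at_most_2 arc col.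
Hypothesis C5C3 : C5_at_most_3 arc col \/ C3upC3_at_most_2 arc col.

(** Otherwise the distance is exactly 4, and a path [u, a, b, c, v] has no forward chord. Hence any
    two non-consecutive vertices of it in different parts are joined by a backward arc, which closes
    the cycles in the hypotheses. *)
Lemma near_colored_path_le3 u v :
  u != v -> near u v -> colored_path_le arc col 3 u v.
Proof.
move=> nuv /nearP[p0 [P0 l0 sz0]].
have [/colored_path_leP //|/colored_path_leP nR] :=
  boolP (colored_path_leb 3 u v).
have short q : path arc u q -> last u q = v -> size q <= 3 -> False.
  move=> Pq lq szq; apply: nR; rewrite -lq.
  by apply: short_colored_path_le; rewrite ?lq.
move: l0; case: (shortenP P0) => p Pp up pp0 lp.
have {p0 P0 sz0 pp0} szp : size p <= 4.
  by apply: leq_trans sz0; apply: uniq_leq_size => //; case/andP: up.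
have [szp3|sz4] := leqP (size p) 3; first by case: (short p).
have {szp sz4} /eqP szp : size p == 4 by rewrite eqn_leq szp sz4.
have [cp|] := leqP (ncolors (path_colors col u p)) 3.
  by rewrite -lp; apply: uniq_colored_path_le; rewrite ?lp.
case: p szp Pp up lp => [|a [|b [|c [|d []]]]] //= _.
move=> /and5P[ua ab bc cd _] uniq4 dv; rewrite {d}dv in cd uniq4 *.
rewrite ltnNge => /negP many; exfalso.
(* The arc from [c] to [v] adds at most one color. *)
have first3 : ncolors [:: col u a; col a b; col b c] <= 2 -> False.
  move=> le2; apply: many.
  apply: leq_trans (_ : ncolors [:: col c v; col u a; col a b; col b c] <= 3).
    by apply: ncolors_sub => x; rewrite !inE => /or4P[] ->; rewrite ?orbT.
  by apply: leq_trans (ncolors_cons _ _) _.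
have uniq_sub s : subseq s [:: u; a; b; c; v] -> uniq s.
  by move=> /subseq_uniq; apply.
have no_arc_uc : ~~ arc u c.
  by apply/negP => uc; apply: (short [:: c; v]); rewrite //= uc cd.
have [puc|puc] := eqVneq (part u) (part c); last first.
  have cu := arc_rev puc no_arc_uc.
  apply: first3; apply: leq_trans (C4 (uniq_sub [:: u; a; b; c] _) ua ab bc cu).
    by apply: ncolors_sub => x; rewrite !inE => /or3P[] ->; rewrite ?orbT.
  exact: (prefix_subseq [:: u; a; b; c]).
have [C5|C3] := C5C3.
  have vu : arc v u.
    apply: arc_rev; first by rewrite puc arc_part.
    by apply/negP => uv; apply: (short [:: v]); rewrite //= uv.
  apply: many; apply: leq_trans (C5 _ _ _ _ _ uniq4 ua ab bc cd vu).
  by apply: ncolors_sub => x; rewrite !inE => /or4P[] ->; rewrite ?orbT.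
have bu : arc b u.
  apply: arc_rev; first by rewrite puc eq_sym arc_part.
  by apply/negP => ub; apply: (short [:: b; c; v]); rewrite //= ub bc cd.
have ca : arc c a.
  apply: arc_rev; first by rewrite -puc eq_sym arc_part.
  by apply/negP => ac; apply: (short [:: a; c; v]); rewrite //= ua ac cd.
have uniq_bcau : uniq [:: b; c; a; u].
  rewrite -(rot_uniq 2) (uniq_catCA [:: a] [:: u] [:: b; c]).
  by apply: uniq_sub; apply: (prefix_subseq [:: u; a; b; c]).
(* The two triangles are [a, b, c] and [a, b, u], with the arc from [a] to [b] in common; together
   they contain the first three arcs of the path. *)
apply: first3; apply: leq_trans (C3 _ _ _ _ uniq_bcau bc ca ab bu ua).
by apply: ncolors_sub => x; rewrite !inE => /or3P[] ->; rewrite ?orbT.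
Qed.

End SemicompleteMultipartite.
End ColoredPaths.

Theorem mainTheorem7 (V : finType) (r : nat) (arc : rel V) (part : V -> 'I_r)
  (col : V -> V -> nat) :
  3 <= r ->
  semicomplete_multipartite arc part ->
  C4_at_most_2 arc col ->
  (C5_at_most_3 arc col \/ C3upC3_at_most_2 arc col) ->
  exists K : {set V}, k_colored_kernel arc col 3 K.
Proof.
move=> _ [r_ge2 part_surj indep semicomplete] C4 C5C3.
have far u v : colored_path_leb arc col 3 u v ->
    ~~ colored_path_leb arc col 3 v u -> far_above arc u v.
  move=> /colored_path_leP Ruv nRvu; rewrite /far_above.
  rewrite (colored_path_le_connect Ruv).
  have [uv|nvu] := eqVneq v u.
    by case/negP: nRvu; apply/colored_path_leP; rewrite uv in Ruv *.
  apply: contra nRvu => near_vu; apply/colored_path_leP.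
  exact: (near_colored_path_le3 indep semicomplete C4 C5C3).
have [K [_ Kabs Kind]] := kernel_of_acyclic_asymmetric_part [set: V]
  (@far_above_irr V arc) (far_above_trans indep semicomplete) far.
have absorb u : u \notin K -> exists2 v, v \in K & colored_path_le arc col 3 u v.
  move=> uK; have [v vK /colored_path_leP Ruv] := Kabs u (in_setT u) uK.
  by exists v.
exists K; split=> // [|u v uK vK uv /colored_path_leP].
  (* Partite sets are nonempty, so there is a vertex; it lies in [K] or is absorbed by a member of
     [K]. *)
  have [v _] := part_surj (Ordinal (ltnW r_ge2)).
  have [vK|/absorb[w wK _]] := boolP (v \in K); apply/set0Pn; [by exists v|by exists w].
exact/negP/Kind.
Qed.
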